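(* Let $\Phi_{KZ}$ be the Drinfel'd associator and $\mathcal A=\{X_{34},X_{45},X_{24},X_{12},X_{23}\}^*$. With the convention $\zeta^{sh}(0)=0$, the relation $$\Phi_{KZ}(X_{12},X_{23})\Phi_{KZ}(X_{34},X_{45})\Phi_{KZ}(X_{51},X_{12})\Phi_{KZ}(X_{23},X_{34})\Phi_{KZ}(X_{45},X_{51})=1\quad\text{in }U\mathfrak B_5$$ is equivalent to the family of relations: for all $b_4\in B_4$, $b_4\ne1$, $$\sum_{W\in\mathcal A}l_{b_4,W}\Bigg(\sum_{\substack{U_1,\ldots,U_5\in\mathcal A\\ U_1\cdots U_5=W}}(-1)^{d_1(U_1)+d_2(U_2)+d_3(U_3)+d_4(U_4)+d_5(U_5)}\,\zeta^{sh}(\rho_1(U_1))\zeta^{sh}(\rho_2(U_2))\zeta^{sh}(\rho_3(U_3))\zeta^{sh}(\rho_4(U_4))\zeta^{sh}(\rho_5(U_5))\Bigg)=0,$$ where $d_i(U)$ is the depth of $\rho_i(U)$.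
   Context: $S^*$ is the set of words in $S$ (with empty word $\emptyset=1$). The depth of a word in $X_0,X_1$ is its number of letters $X_1$, written $\mathrm{dp}$. The shuffle-regularized multiple zeta values $(\zeta^{sh}(W))_{W\in\{X_0,X_1\}^*}$ are the real numbers determined by: $\zeta^{sh}(X_0)=\zeta^{sh}(X_1)=0$; $\zeta^{sh}(X_0^{k_1-1}X_1\cdots X_0^{k_p-1}X_1)=\sum_{n_1>\cdots>n_p>0}n_1^{-k_1}\cdots n_p^{-k_p}$ if $k_1\ge2$; $\zeta^{sh}(V)\zeta^{sh}(W)=\sum_U\zeta^{sh}(U)$ over all shuffles $U$ of $V,W$ (with multiplicity); $\zeta^{sh}(\emptyset)=1$. The Drinfel'd associator in $\mathbb C\langle\langle X_0,X_1\rangle\rangle$ is $\Phi_{KZ}(X_0,X_1)=\sum_W(-1)^{\mathrm{dp}(W)}\zeta^{sh}(W)W$; $\Phi_{KZ}(A,B)$ denotes substitution. $U\mathfrak B_5$ is the quotient of $\mathbb C\langle\langle X_{ij}\rangle\rangle$ ($1\le i,j\le5$) by $X_{ii}=0$, $X_{ij}=X_{ji}$, $\sum_jX_{ij}=0$ for each $i$, and $[X_{ij},X_{kl}]=0$ if $\{i,j\}\cap\{k,l\}=\emptyset$. $B_4$ is the basis of $U\mathfrak B_5$ formed by the elements $UV$ with $U\in\{X_{24},X_{34},X_{45}\}^*$ and $V\in\{X_{12},X_{23}\}^*$ (including $1$); it comes from the identification $U\mathfrak B_5\simeq\mathbb C\langle\langle X_{24},X_{34},X_{45}\rangle\rangle\rtimes\mathbb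 C\langle\langle X_{12},X_{23}\rangle\rangle$. For $W\in\mathcal A$, the coefficients $l_{b_4,W}$ are defined by $W=\sum_{b_4\in B_4}l_{b_4,W}b_4$ in $U\mathfrak B_5$ (for each $b_4$ only finitely many $W$ have $l_{b_4,W}\neq 0$). $\rho_1,\ldots,\rho_5$ are the multiplicative maps from $\mathcal A$ to $\{X_0,X_1\}^*\cup\{0\}$ with $\rho_i(\emptyset)=1$ and: $\rho_1$: $X_{12}\mapsto X_0$, $X_{23}\mapsto X_1$, other letters $\mapsto0$; $\rho_2$: $X_{34}\mapsto X_0$, $X_{45}\mapsto X_1$, others $\mapsto0$; $\rho_3$: $X_{12}\mapsto X_1$, $X_{23},X_{34},X_{24}\mapsto X_0$, $X_{45}\mapsto0$; $\rho_4$: $X_{23}\mapsto X_0$, $X_{34}\mapsto X_1$, others $\mapsto0$; $\rho_5$: $X_{45}\mapsto X_0$, $X_{23},X_{34},X_{24}\mapsto X_1$, $X_{12}\mapsto0$. If $\rho_i(U)=0$ the corresponding term is $0$, whatever sign is assigned. *)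

(* Defs.v *)
From HB Require Import structures.
From mathcomp Require Import all_boot all_order all_algebra.
From mathcomp Require Import all_classical all_reals all_analysis.
From mathcomp Require Import complex.

Set Implicit Arguments.
Unset Strict Implicit.
Unset Printing Implicit Defensive.

Import Order.TTheory GRing.Theory Num.Theory.

Local Open Scope classical_set_scope.
Local Open Scope ring_scope.

(** * Noncommutative formal power series *)

(* A series is the family of its coefficients on the words in [T].  The alias
   replaces the pointwise product of [seq T -> K] by the Cauchy product. *)
Definition ncseries (K : pzRingType) (T : Type) : Type := seq T -> K.

HB.instance Definition _ (K : pzRingType) (T : Type) :=
  Choice.copy (ncseries K T) (seq T -> K).

Section NCSeriesRing.
Variables (K : pzRingType) (T : Type).
Implicit Types f g h : ncseries K T.

Definition nczero : ncseries K T := fun=> 0.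
Definition ncopp f : ncseries K T := fun w => - f w.
Definition ncadd f g : ncseries K T := fun w => f w + g w.

Lemma ncaddA : associative ncadd.
Proof. by move=> f g h; apply/funext => w; rewrite /ncadd addrA. Qed.

Lemma ncaddC : commutative ncadd.
Proof. by move=> f g; apply/funext => w; rewrite /ncadd addrC. Qed.

Lemma ncadd0f : left_id nczero ncadd.
Proof. by move=> f; apply/funext => w; rewrite /ncadd add0r. Qed.

Lemma ncaddNf : left_inverse nczero ncopp ncadd.
Proof. by move=> f; apply/funext => w; rewrite /ncadd addNr. Qed.

Definition ncone : ncseries K T := fun w => (nilp w)%:R.

Definition ncmul f g : ncseries K T :=
  fun w => \sum_(i < (size w).+1) f (take i w) * g (drop i w).

Lemma ncmulA : associative ncmul.
Proof.
move=> f g h; apply/funext => w; rewrite /ncmul; symmetry.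
pose F (i j : nat) :=
  f (take i w) * g (take (j - i) (drop i w)) * h (drop j w).
transitivity (\sum_(0 <= j < (size w).+1) \sum_(0 <= i < j.+1) F i j).
  rewrite big_mkord; apply: eq_bigr => j _.
  have jw : (j <= size w)%N := ltn_ord j.
  rewrite big_mkord mulr_suml size_takel//; apply: eq_bigr => i _.
  have ij : (i <= j)%N := ltn_ord i.
  by rewrite /F take_takel// take_drop subnK.
transitivity (\sum_(0 <= i < (size w).+1) \sum_(i <= j < (size w).+1) F i j).
  rewrite (eq_big_nat _ _ (F2 := fun j =>
    \sum_(0 <= i < (size w).+1 | (i <= j)%N) F i j)); last first.
    by move=> j /andP[_ jw]; rewrite (big_nat_widen _ _ (size w).+1).
  rewrite (exchange_big_dep_nat xpredT)//=; apply: eq_big_nat => i _.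
  by rewrite [RHS](@big_nat_widenl _ _ _ i 0).
rewrite big_mkord; apply: eq_bigr => i _.
have iw : (i <= size w)%N := ltn_ord i.
rewrite mulr_sumr -{1}[nat_of_ord i]add0n big_addn big_mkord.
rewrite subSn// size_drop; apply: eq_bigr => k _.
by rewrite /F addnK drop_drop mulrA.
Qed.

Lemma ncmul1f : left_id ncone ncmul.
Proof.
move=> f; apply/funext => w; rewrite /ncmul big_ord_recl take0 drop0 /ncone.
rewrite mul1r big1 ?addr0// => i _.
by case: w i => [[]//|x w i]; rewrite mul0r.
Qed.

Lemma ncmulf1 : right_id ncone ncmul.
Proof.
move=> f; apply/funext => w; rewrite /ncmul big_ord_recr /= take_size drop_size.
rewrite /ncone mulr1 big1 ?add0r// => i _.
by rewrite /nilp size_drop subn_eq0 leqNgt ltn_ord mulr0.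
Qed.

Lemma ncmulDl : left_distributive ncmul ncadd.
Proof.
move=> f g h; apply/funext => w; rewrite /ncadd -big_split.
by apply: eq_bigr => i _; rewrite mulrDl.
Qed.

Lemma ncmulDr : right_distributive ncmul ncadd.
Proof.
move=> f g h; apply/funext => w; rewrite /ncadd -big_split.
by apply: eq_bigr => i _; rewrite mulrDr.
Qed.

End NCSeriesRing.

HB.instance Definition _ (K : pzRingType) (T : Type) :=
  GRing.isZmodule.Build (ncseries K T)
    (@ncaddA K T) (@ncaddC K T) (@ncadd0f K T) (@ncaddNf K T).

HB.instance Definition _ (K : pzRingType) (T : Type) :=
  GRing.Zmodule_isPzRing.Build (ncseries K T)
    (@ncmulA K T) (@ncmul1f K T) (@ncmulf1 K T)
    (@ncmulDl K T) (@ncmulDr K T).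

Definition ncword (K : pzRingType) (T : eqType) (v : seq T) : ncseries K T :=
  fun w => (w == v)%:R.

(* f(A, B) for A and B without constant term: the words longer than w do not
   contribute to the coefficient of w, which is therefore a finite sum. *)
Definition ncsubst (K : pzRingType) (T : Type)
    (f : ncseries K bool) (A B : ncseries K T) : ncseries K T :=
  fun w => \sum_(n < (size w).+1) \sum_(t : n.-tuple bool)
    f t * (\prod_(x <- t) (if x then B else A)) w.

Section ClosedIdeals.
Variables (K : pzRingType) (T : Type).

Definition two_sided_ideal (I : set (ncseries K T)) : Prop :=
  [/\ I 0,
      forall f g, I f -> I g -> I (f - g)
    & forall a f, I f -> I (a * f) /\ I (f * a)].

(* Closedness for the adic topology of the length filtration. *)
Definition adic_closed (I : set (ncseries K T)) : Prop :=
  forall f,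
    (forall n, exists2 g, I g & forall w, (size w < n)%N -> f w = g w) -> I f.

(* Quotients of a ring of formal series are quotients by closed ideals. *)
Definition closed_ideal_gen (S : set (ncseries K T)) : set (ncseries K T) :=
  smallest (fun I => two_sided_ideal I /\ adic_closed I) S.

End ClosedIdeals.

(** * Shuffle-regularized multiple zeta values *)

(* Words in X_0 and X_1 are words in [bool]: [false] is X_0, [true] is X_1. *)
Definition depth (W : seq bool) : nat := count id W.

(* The list of all shuffles of two words, with multiplicity. *)
Fixpoint shuffle (V : seq bool) : seq bool -> seq (seq bool) :=
  fix shuffleV W :=
    match V, W with
    | [::], _ => [:: W]
    | _, [::] => [:: V]
    | x :: V', y :: W' =>
        [seq x :: U | U <- shuffle V' W] ++ [seq y :: U | U <- shuffleV W']
    end.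

(* X_0^(k_1 - 1) X_1 ... X_0^(k_p - 1) X_1 *)
Definition mzv_word (k : seq nat) : seq bool :=
  flatten [seq rcons (nseq m.-1 false) true | m <- k].

Definition mzv (R : realType) (k : seq nat) : \bar R :=
  \esum_(n in [set n : seq nat | size n = size k /\ sorted gtn (rcons n 0%N)])
    (\prod_(i < size k) ((nth 0%N n i)%:R ^- nth 0%N k i))%:E.

Record is_zeta_sh (R : realType) (zeta : seq bool -> R) : Prop := {
  zeta_sh_nil : zeta [::] = 1;
  zeta_sh_X0 : zeta [:: false] = 0;
  zeta_sh_X1 : zeta [:: true] = 0;
  zeta_sh_mzv : forall k : seq nat,
    all (leq 1) k -> (2 <= head 0 k)%N -> (zeta (mzv_word k))%:E = mzv R k;
  zeta_sh_shuffle : forall V W,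
    zeta V * zeta W = \sum_(U <- shuffle V W) zeta U
}.

(* Extension to {X_0, X_1}^* with a zero [None] adjoined. *)
Definition zeta0 (R : realType) (zeta : seq bool -> R) (W : option (seq bool)) :=
  oapp zeta 0 W.

Definition depth0 (W : option (seq bool)) : nat := oapp depth 0%N W.

Definition Phi_KZ (R : realType) (zeta : seq bool -> R) : ncseries R[i] bool :=
  fun W => (-1) ^+ depth W * (zeta W)%:C%C.

(** * The algebra U B_5 *)

(* The pair (i, j) is the variable X_ij; the indices 1, ..., 5 are encoded by
   the elements 0, ..., 4 of 'I_5. *)
Definition letter : finType := ('I_5 * 'I_5)%type.

Definition ix1 : 'I_5 := @Ordinal 5 0 isT.
Definition ix2 : 'I_5 := @Ordinal 5 1 isT.
Definition ix3 : 'I_5 := @Ordinal 5 2 isT.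
Definition ix4 : 'I_5 := @Ordinal 5 3 isT.
Definition ix5 : 'I_5 := @Ordinal 5 4 isT.

Definition X12 : letter := (ix1, ix2).
Definition X23 : letter := (ix2, ix3).
Definition X24 : letter := (ix2, ix4).
Definition X34 : letter := (ix3, ix4).
Definition X45 : letter := (ix4, ix5).
Definition X51 : letter := (ix5, ix1).

Section UB5.
Variable R : realType.
Implicit Types f g : ncseries R[i] letter.

Definition ncX (x : letter) : ncseries R[i] letter := ncword R[i] [:: x].

Inductive UB5_relator : set (ncseries R[i] letter) :=
| UB5_diag i : UB5_relator (ncX (i, i))
| UB5_sym i j : UB5_relator (ncX (i, j) - ncX (j, i))
| UB5_sum i : UB5_relator (\sum_(j < 5) ncX (i, j))
| UB5_comm i j k l : i \notin [:: k; l] -> j \notin [:: k; l] ->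
    UB5_relator (ncX (i, j) * ncX (k, l) - ncX (k, l) * ncX (i, j)).

(* Equality in the quotient U B_5. *)
Definition eqUB5 f g : Prop := closed_ideal_gen UB5_relator (f - g).

Definition words_in (L : seq letter) : set (seq letter) := [set w | all (mem L) w].

Definition B4 : set (seq letter) :=
  [set w | exists U V, [/\ words_in [:: X24; X34; X45] U,
                           words_in [:: X12; X23] V & w = U ++ V]].

(* The sum of the c(b) b over b in B_4, as a series. *)
Definition B4_comb (c : seq letter -> R[i]) : ncseries R[i] letter :=
  fun w => if w \in B4 then c w else 0.

(* B4 being a topological basis of U B_5, such a family exists and is unique on
   B4; its values outside B4 are irrelevant. *)
Definition B4_coefs (W : seq letter) : seq letter -> R[i] :=
  xget (fun=> 0) [set c | eqUB5 (ncword R[i] W) (B4_comb c)].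

Definition l_coef (b W : seq letter) : R[i] := B4_coefs W b.

Definition Phi_at (zeta : seq bool -> R) (x y : letter) : ncseries R[i] letter :=
  ncsubst (Phi_KZ zeta) (ncX x) (ncX y).

End UB5.

(** * The family of relations *)

Definition calA : set (seq letter) := words_in [:: X34; X45; X24; X12; X23].

(* Row i lists the letters sent by rho_(i+1) to X_0 and those sent to X_1; the
   other letters are sent to 0. *)
Definition rho_table : seq (seq letter * seq letter) :=
  [:: ([:: X12], [:: X23]);
      ([:: X34], [:: X45]);
      ([:: X23; X34; X24], [:: X12]);
      ([:: X23], [:: X34]);
      ([:: X45], [:: X23; X34; X24])].

Definition rho_letter (i : 'I_5) (x : letter) : option bool :=
  let: (to0, to1) := nth ([::], [::]) rho_table i in
  if x \in to0 then Some false else if x \in to1 then Some true else None.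

Fixpoint rho (i : 'I_5) (U : seq letter) : option (seq bool) :=
  if U is x :: U' then
    if (rho_letter i x, rho i U') is (Some a, Some V) then Some (a :: V)
    else None
  else Some [::].

Definition factorizations (W : seq letter) : set (5.-tuple (seq letter)) :=
  [set U | (forall i, calA (tnth U i)) /\ flatten U = W].

Definition pentagon_coef (R : realType) (zeta : seq bool -> R)
    (W : seq letter) : R :=
  \sum_(U \in factorizations W)
    ((-1) ^+ (\sum_(i < 5) depth0 (rho i (tnth U i)))%N *
     \prod_(i < 5) zeta0 zeta (rho i (tnth U i))).

(* Main.v *)
From HB Require Import structures.
Require Import Defs.
From mathcomp Require Import all_boot all_order all_algebra.
From mathcomp Require Import all_classical all_reals all_analysis.
From mathcomp Require Import complex.
From mathcomp Require Import ring.

Import Order.TTheory GRing.Theory Num.Theory.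

Local Open Scope classical_set_scope.
Local Open Scope ring_scope.

(** The relation is an equality in [U B_5], and the family of relations reads it
    off coefficient by coefficient in the basis [B_4].

    The variable [X51] equals [X23 + X34 + X24] in [U B_5], so each of the five
    factors is congruent to the series on [A] whose coefficient on a word [U] is
    [(-1)^d_i(U) zeta(rho_i(U))] ([congr_Phi], [ncsubst_rho]); the Cauchy product
    then says that the left-hand side is congruent to the sum of the [p(W) W],
    where [p(W)] is the inner sum of the family ([pentagon_congr],
    [pentagon_coefE]).  Expanding each [W] in [B_4], the coefficient of [b] is the
    sum of the [l_(b,W) p(W)].  At [b = 1] it is [1], so the product is [1] exactly
    when the others vanish.

    What has to be proved for this is that [B_4] is a topological basis.  Write
    [s, t, a, b, c] for [X12, X23, X24, X34, X45].  The other variables are linear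
    combinations of these, and the relations amount to [[s, b] = [s, c] = [t, c] =
    0], [[s, a] = [b + c, a]], [[t, a] = [a, b]] and [[t, b] = [b, a]]: the letters
    [s] and [t] act by derivations on the free algebra on [a, b, c].

    Independence: the space of all series is used as a model, on which [a, b, c]
    act by left multiplication and [s, t] by an operator that carries them over a
    maximal prefix in [a, b, c] with the help of these commutators
    ([semidirect_op]).  The operators satisfy all the relations
    ([UB5_relator_annihilated], a finite check on the coordinates of the
    variables), so the action of a series on [1], its [normal_form], depends only
    on its class in [U B_5]; and a word of [B_4] sends [1] to itself
    ([act_normal]).

    Spanning: modulo the relations, left multiplication by a letter of [A] is its
    operator on the model ([letter_op_congr]), so a series on [A] is congruent to
    its normal form ([congr_normal_form]).  Both facts concern infinite sums, and
    are proved by induction on the order up to which they hold, the ideal being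
    closed.

    Hence [l_(b,W)] is the coefficient at [b] of the action of [W] on [1]
    ([l_coefE]).  The action is homogeneous, so only the [W] of the length of [b]
    contribute, and the sum over [W] is the coefficient at [b] of the normal form
    of the product ([pentagon_normal_form]). *)

Set Implicit Arguments.
Unset Strict Implicit.
Unset Printing Implicit Defensive.

(** * Series as a module, and stripping a leading letter *)

Section SeriesModule.
Variables (K : pzRingType) (T : Type).
Implicit Types (c : K) (f g : ncseries K T).

Definition ncscale c f : ncseries K T := fun w => c * f w.

Lemma ncscaleA c d f : ncscale c (ncscale d f) = ncscale (c * d) f.
Proof. by apply/funext => w; rewrite /ncscale mulrA. Qed.

Lemma ncscale1 : left_id 1 ncscale.
Proof. by move=> f; apply/funext => w; rewrite /ncscale mul1r. Qed.

Lemma ncscaleDr : right_distributive ncscale +%R.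
Proof. by move=> c f g; apply/funext => w; apply: mulrDr. Qed.

Lemma ncscaleDl f : {morph ncscale^~ f : c d / c + d}.
Proof. by move=> c d; apply/funext => w; apply: mulrDl. Qed.

HB.instance Definition _ :=
  GRing.Zmodule_isLmodule.Build K (ncseries K T)
    ncscaleA ncscale1 ncscaleDr ncscaleDl.

Lemma ncaddE f g w : (f + g) w = f w + g w. Proof. by []. Qed.
Lemma ncoppE f w : (- f) w = - f w. Proof. by []. Qed.
Lemma ncsubE f g w : (f - g) w = f w - g w. Proof. by []. Qed.
Lemma ncscaleE c f w : (c *: f) w = c * f w. Proof. by []. Qed.
Lemma nconeE w : (1 : ncseries K T) w = (nilp w)%:R. Proof. by []. Qed.

Lemma ncsumE I (r : seq I) (P : pred I) (F : I -> ncseries K T) w :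
  (\sum_(i <- r | P i) F i) w = \sum_(i <- r | P i) F i w.
Proof. exact: (big_morph (fun f : ncseries K T => f w)). Qed.

Lemma ncmulE f g w :
  (f * g) w = \sum_(i < (size w).+1) f (take i w) * g (drop i w).
Proof. by []. Qed.

Lemma ncseriesP f g : f =1 g -> f = g.
Proof. exact: funext. Qed.

(** The series [f_x] of the decomposition [f = f(1) + \sum_x x f_x]. *)
Definition lstrip (x : T) f : ncseries K T := fun w => f (x :: w).

Lemma lstrip_linear x : linear (lstrip x). Proof. by []. Qed.

HB.instance Definition _ x :=
  GRing.isLinear.Build K (ncseries K T) (ncseries K T) _ (lstrip x)
    (lstrip_linear x).

Lemma ncmul_nil f g : (f * g) [::] = f [::] * g [::].
Proof. by rewrite ncmulE big_ord_recl big_ord0 addr0. Qed.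

(** The leading letter of a product comes from the first factor, or from the
    second where the first contributes its constant term. *)
Lemma lstripM x f g : lstrip x (f * g) = f [::] *: lstrip x g + lstrip x f * g.
Proof. by apply: ncseriesP => w; rewrite /lstrip ncmulE big_ord_recl. Qed.

Lemma lstrip1 x : lstrip x 1 = 0. Proof. by []. Qed.

Lemma lstrip_ext f g :
  f [::] = g [::] -> (forall x, lstrip x f = lstrip x g) -> f = g.
Proof.
move=> fg0 fg; apply: ncseriesP => -[//|x w].
by rewrite -[LHS]/(lstrip x f w) fg.
Qed.

Lemma nc_scalerAl c f g : c *: (f * g) = (c *: f) * g.
Proof.
apply: ncseriesP => w; rewrite ncscaleE !ncmulE mulr_sumr.
by apply: eq_bigr => i _; rewrite ncscaleE mulrA.
Qed.

(** Only finitely many words of the substituted series reach a given coefficient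
    when the substituted letters have no constant term. *)
Lemma ncprod_order I (r : seq I) (F : I -> ncseries K T) w :
  (forall i, F i [::] = 0) -> (size w < size r)%N -> (\prod_(i <- r) F i) w = 0.
Proof.
move=> F0; elim: r w => [//|i r IH] [|x w] szw; rewrite big_cons.
  by rewrite ncmul_nil F0 mul0r.
rewrite -[LHS]/(lstrip x _ w) lstripM F0 scale0r add0r ncmulE big1 // => j _.
rewrite IH ?mulr0 // size_drop.
by move: szw; rewrite /= ltnS; apply: leq_trans; rewrite ltnS leq_subr.
Qed.

End SeriesModule.

Lemma nc_scalerAr (K : comPzRingType) (T : Type) c (f g : ncseries K T) :
  c *: (f * g) = f * (c *: g).
Proof.
apply: ncseriesP => w; rewrite ncscaleE !ncmulE mulr_sumr.
by apply: eq_bigr => i _; rewrite ncscaleE mulrCA.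
Qed.

Section Letters.
Variables (K : pzRingType) (T : eqType).
Implicit Types (f g : ncseries K T) (x y : T).

Definition ncletter x : ncseries K T := ncword K [:: x].

Lemma ncletter_nil x : ncletter x [::] = 0. Proof. by []. Qed.

Lemma ncword_nil : ncword K [::] = 1 :> ncseries K T.
Proof. by apply: ncseriesP => -[]. Qed.

Lemma lstrip_word x y w :
  lstrip x (ncword K (y :: w)) = (x == y)%:R *: ncword K w.
Proof.
apply: ncseriesP => v; rewrite ncscaleE /lstrip /ncword eqseq_cons.
by case: (x == y); rewrite ?mul0r ?mul1r.
Qed.

Lemma lstrip_letter x y : lstrip x (ncletter y) = (x == y)%:R *: (1 : ncseries K T).
Proof. by rewrite /ncletter lstrip_word ncword_nil. Qed.

Lemma lstrip_lmul x y f : lstrip x (ncletter y * f) = (x == y)%:R *: f.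
Proof.
by rewrite lstripM ncletter_nil scale0r add0r lstrip_letter -nc_scalerAl mul1r.
Qed.

Lemma ncword_cons x w : ncword K (x :: w) = ncletter x * ncword K w.
Proof.
apply: lstrip_ext => [|y]; first by rewrite ncmul_nil mul0r.
by rewrite lstrip_word lstrip_lmul.
Qed.

Lemma lmul_cons x y w f : (ncletter x * f) (y :: w) = (y == x)%:R * f w.
Proof. by rewrite -[LHS]/(lstrip y _ w) lstrip_lmul ncscaleE. Qed.

End Letters.

Lemma ncletter_linear (K : comPzRingType) (T : eqType) (x : T) :
  linear (fun f : ncseries K T => ncletter K x * f).
Proof. by move=> c f g; rewrite mulrDr nc_scalerAr. Qed.

Lemma nc_decomp (K : pzRingType) (T : finType) (f : ncseries K T) :
  f = f [::] *: (1 : ncseries K T) + \sum_x ncletter K x * lstrip x f.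
Proof.
apply: lstrip_ext => [|y].
  rewrite ncaddE ncscaleE mulr1 ncsumE big1 ?addr0 // => x _.
  by rewrite ncmul_nil mul0r.
rewrite linearD linear_sum linearZ /= lstrip1 scaler0 add0r (bigD1 y) //=.
rewrite lstrip_lmul eqxx scale1r big1 ?addr0 // => x /negPf xy.
by rewrite lstrip_lmul eq_sym xy scale0r.
Qed.

(** * Closed two-sided ideals *)

Section ClosedIdealTheory.
Variables (K : pzRingType) (T : Type).
Variable I : set (ncseries K T).
Hypotheses (Iid : two_sided_ideal I) (Icl : adic_closed I).
Implicit Types f g : ncseries K T.

Lemma ideal0 : I 0. Proof. by case: Iid. Qed.
Lemma idealB f g : I f -> I g -> I (f - g). Proof. by case: Iid => _ + _; apply. Qed.
Lemma idealN f : I f -> I (- f).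
Proof. by move=> If; rewrite -[- f]add0r; apply: idealB => //; apply: ideal0. Qed.
Lemma idealD f g : I f -> I g -> I (f + g).
Proof. by move=> If Ig; rewrite -[g]opprK; apply: idealB => //; apply: idealN. Qed.
Lemma idealMl f g : I g -> I (f * g). Proof. by case: Iid => _ _ H /(H f)[]. Qed.
Lemma idealMr f g : I f -> I (f * g). Proof. by case: Iid => _ _ H /(H g)[]. Qed.
Lemma idealZ c f : I f -> I (c *: f).
Proof. by move=> If; rewrite -[f]mul1r nc_scalerAl; apply: idealMl. Qed.

Lemma ideal_sum J (r : seq J) (P : pred J) (F : J -> ncseries K T) :
  (forall i, P i -> I (F i)) -> I (\sum_(i <- r | P i) F i).
Proof. by move=> IF; apply: (big_ind I) => //; [apply: ideal0 | apply: idealD]. Qed.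

Definition congr f g := I (f - g).

Lemma congr_refl f : congr f f.
Proof. by rewrite /congr subrr; apply: ideal0. Qed.
Lemma congr_sym f g : congr f g -> congr g f.
Proof. by move=> /idealN; rewrite opprB. Qed.
Lemma congr_trans f g h : congr f g -> congr g h -> congr f h.
Proof. by move=> fg /(idealD fg); rewrite addrA subrK. Qed.
Lemma congrD f f' g g' : congr f f' -> congr g g' -> congr (f + g) (f' + g').
Proof. by move=> ff gg; rewrite /congr opprD addrACA; apply: idealD. Qed.
Lemma congrM f f' g g' : congr f f' -> congr g g' -> congr (f * g) (f' * g').
Proof.
move=> ff gg; rewrite /congr -(subrK (f' * g) (f * g)) -addrA -mulrBl -mulrBr.
by apply: idealD; [apply: idealMr | apply: idealMl].
Qed.
Lemma congr_prod J (r : seq J) (F G : J -> ncseries K T) :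
  (forall i, congr (F i) (G i)) -> congr (\prod_(i <- r) F i) (\prod_(i <- r) G i).
Proof.
move=> FG; apply: (big_ind2 congr) => [|f f' g g'|i _]; first exact: congr_refl.
  exact: congrM.
exact: FG.
Qed.

(** For a closed ideal, satisfying this for all [n] is membership, so that the
    infinite reduction of a series to a normal form can be justified by induction
    on [n]. *)
Definition near_ideal n f :=
  exists2 g, I g & forall w, (size w < n)%N -> f w = g w.

Lemma near_idealP f : (forall n, near_ideal n f) -> I f.
Proof. exact: Icl. Qed.

Lemma ideal_near n f : I f -> near_ideal n f. Proof. by exists f. Qed.

Lemma near_ideal0 f : near_ideal 0 f.
Proof. by exists 0; [apply: ideal0|]. Qed.

Lemma near_idealD n f g : near_ideal n f -> near_ideal n g -> near_ideal n (f + g).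
Proof.
move=> [f' If' ff'] [g' Ig' gg']; exists (f' + g'); first exact: idealD.
by move=> w wn; rewrite !ncaddE ff' ?gg'.
Qed.

Lemma near_ideal_sum n J (r : seq J) (F : J -> ncseries K T) :
  (forall i, near_ideal n (F i)) -> near_ideal n (\sum_(i <- r) F i).
Proof.
move=> IF; apply: (big_ind (near_ideal n)) => //.
  by apply: ideal_near; apply: ideal0.
exact: near_idealD.
Qed.

(** The factor without constant term gains one order; this drives the inductions
    on [n]. *)
Lemma near_ideal_lmul n (x : ncseries K T) f :
  x [::] = 0 -> near_ideal n f -> near_ideal n.+1 (x * f).
Proof.
move=> x0 [g Ig fg]; exists (x * g); first exact: idealMl.
move=> w wn; rewrite !ncmulE !big_ord_recl take0 x0 !mul0r; congr (_ + _).
apply: eq_bigr => i _; rewrite fg // size_drop lift0 ltn_subLR //.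
by rewrite addSn ltnS (leq_trans _ (leq_addl i n)) // -ltnS.
Qed.

(** Truncated at length [n], a substitution is a finite combination of products,
    which respect congruence; closedness passes to the limit. *)
Lemma congr_subst (f : ncseries K bool) (A A' B B' : ncseries K T) :
  A [::] = 0 -> A' [::] = 0 -> B [::] = 0 -> B' [::] = 0 ->
  congr A A' -> congr B B' -> congr (ncsubst f A B) (ncsubst f A' B').
Proof.
move=> A0 A0' B0 B0' AA BB; apply: near_idealP => n.
pose P (C D : ncseries K T) (t : seq bool) := \prod_(x <- t) (if x then D else C).
pose trunc C D : ncseries K T :=
  \sum_(k < n) \sum_(t : k.-tuple bool) f t *: P C D t.
exists (trunc A B - trunc A' B').
  rewrite /trunc -sumrB; apply: ideal_sum => k _.
  rewrite -sumrB; apply: ideal_sum => t _; rewrite -scalerBr; apply: idealZ.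
  by apply: congr_prod => -[].
suff H C D w : C [::] = 0 -> D [::] = 0 -> (size w < n)%N ->
    ncsubst f C D w = trunc C D w by move=> w wn; rewrite !ncsubE !H.
move=> C0 D0 wn; rewrite /trunc ncsumE /ncsubst.
pose G k := \sum_(t : k.-tuple bool) f t * P C D t w.
transitivity (\sum_(k < n) G k); last first.
  by apply: eq_bigr => k _; rewrite ncsumE.
rewrite (big_ord_widen n G wn) big_mkcond; apply: eq_bigr => k _.
case: ifPn => //; rewrite -leqNgt => wk; rewrite /G big1 // => t _.
rewrite /P ncprod_order ?mulr0 ?size_tuple //.
by case.
Qed.

End ClosedIdealTheory.

Section GeneratedIdeal.
Variables (K : pzRingType) (T : Type) (S : set (ncseries K T)).

Lemma closed_ideal_gen_ideal : two_sided_ideal (closed_ideal_gen S).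
Proof.
split=> [J [[/ideal0]]//|f g If Ig J JS|a f If].
  by apply: (idealB JS.1.1); [apply: If | apply: Ig].
split=> J JS.
  by apply: (idealMl JS.1.1); apply: If.
by apply: (idealMr JS.1.1); apply: If.
Qed.

Lemma closed_ideal_gen_closed : adic_closed (closed_ideal_gen S).
Proof.
move=> f fS J JS; apply: JS.1.2 => n.
by have [g Ig fg] := fS n; exists g => //; apply: Ig.
Qed.

Lemma sub_closed_ideal_gen : S `<=` closed_ideal_gen S.
Proof. exact: sub_gen_smallest. Qed.

Lemma closed_ideal_gen_min (I : set (ncseries K T)) :
  two_sided_ideal I -> adic_closed I -> S `<=` I -> closed_ideal_gen S `<=` I.
Proof. by move=> Iid Icl SI f; apply. Qed.

End GeneratedIdeal.

(** * Graded actions of the ring of series *)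

Section GradedAction.
Variables (K : comPzRingType) (T : finType) (V : lmodType K).
Variable op : T -> {linear V -> V}.
Implicit Types (w : seq T) (f : ncseries K T) (m : V).

Definition act w m : V := foldr (fun x => op x) m w.

Fixpoint words n : seq (seq T) :=
  if n is n'.+1 then [seq x :: w | x <- enum T, w <- words n'] else [:: [::]].

Lemma mem_words n w : (w \in words n) = (size w == n).
Proof.
elim: n w => [|n IH] w; first by rewrite inE -size_eq0.
apply/allpairsP/idP => [[[x v] /= [_ + ->]]|]; first by rewrite IH eqSS.
by case: w => // x w; rewrite eqSS -IH => wn; exists (x, w); rewrite mem_enum.
Qed.

Lemma uniq_words n : uniq (words n).
Proof.
elim: n => [//|n IH]; apply: allpairs_uniq => //; first exact: enum_uniq.
by move=> [x v] [y w] _ _ /= [-> ->].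
Qed.

(** The action is cut into degrees because an infinite sum of operators makes no
    sense on [V]. *)
Definition act_deg n m f : V := \sum_(w <- words n) f w *: act w m.

Lemma act_deg0 f m : act_deg 0 m f = f [::] *: m.
Proof. by rewrite /act_deg big_seq1. Qed.

Lemma act_degS n f m : act_deg n.+1 m f = \sum_x op x (act_deg n m (lstrip x f)).
Proof.
rewrite /act_deg big_allpairs_dep big_enum; apply: eq_bigr => x _.
by rewrite linear_sum; apply: eq_bigr => w _; rewrite linearZ.
Qed.

Lemma act_deg_linear n m : linear (act_deg n m).
Proof.
move=> c f g; rewrite /act_deg scaler_sumr -big_split; apply: eq_bigr => w _ /=.
by rewrite scalerA -scalerDl.
Qed.

HB.instance Definition _ n m :=
  GRing.isLinear.Build K (ncseries K T) V _ (act_deg n m) (act_deg_linear n m).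

Lemma act_deg_arg0 n f : act_deg n 0 f = 0.
Proof.
rewrite /act_deg big1 // => w _; suff -> : act w 0 = 0 by rewrite scaler0.
by elim: w => [//|x w IH] /=; rewrite IH linear0.
Qed.

Lemma act_deg_word n w m :
  act_deg n m (ncword K w) = (size w == n)%:R *: act w m.
Proof.
elim: n w => [|n IH] w.
  by rewrite act_deg0; case: w => [|x w]; rewrite ?scale0r.
rewrite act_degS; case: w => [|y w].
  by rewrite big1 ?scale0r // => x _; rewrite (_ : lstrip _ _ = 0) // !linear0.
rewrite (bigD1 y) //= big1 => [|x /negPf xy].
  by rewrite lstrip_word eqxx scale1r IH addr0 linearZ.
by rewrite lstrip_word xy scale0r !linear0.
Qed.

Lemma act_degM n f g m :
  act_deg n m (f * g) = \sum_(i < n.+1) act_deg i (act_deg (n - i) m g) f.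
Proof.
elim: n f => [|n IH] f.
  by rewrite big_ord_recl big_ord0 addr0 !act_deg0 ncmul_nil scalerA.
rewrite act_degS big_ord_recl act_deg0 subn0.
under [X in _ + X]eq_bigr => i _ do rewrite lift0 act_degS subSS.
rewrite exchange_big /= act_degS scaler_sumr -big_split; apply: eq_bigr => x _ /=.
rewrite lstripM !linearD !linearZ /= IH; congr (_ + _).
exact: linear_sum.
Qed.

Definition annihilator : set (ncseries K T) :=
  [set f | forall n m, act_deg n m f = 0].

(** A degree of the action of a product is a finite sum of products of degrees,
    and a degree of the action of a series depends on finitely many coefficients;
    hence the kernel of the action is a closed
    ideal, and relations satisfied by the operators pass to the ideal that they
    generate. *)
Lemma annihilator_ideal : two_sided_ideal annihilator.
Proof.
split=> [n m|f g Jf Jg n m|a f Jf].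
- exact: linear0.
- by rewrite linearB /= Jf Jg subrr.
split=> n m; rewrite act_degM big1 // => i _.
by rewrite Jf act_deg_arg0.
Qed.

Lemma annihilator_closed : adic_closed annihilator.
Proof.
move=> f Jf n m; have [g Jg fg] := Jf n.+1.
rewrite -[RHS](Jg n m) /act_deg !big_seq; apply: eq_bigr => w.
by rewrite mem_words => /eqP wn; rewrite fg ?wn.
Qed.

End GradedAction.

(** * The action of a generator of the quotient of a semidirect product *)

Definition supported (K : pzRingType) (T : Type) (S : pred (seq T))
  (f : ncseries K T) : Prop := forall w, ~~ S w -> f w = 0.

Section Semidirect.
Variables (K : comPzRingType) (T : finType).
Variables (P : pred T) (delta : T -> ncseries K T) (g : T).
Hypotheses (delta0 : forall x, delta x [::] = 0) (Pg : ~~ P g).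
Implicit Types (f : ncseries K T) (x y : T) (w : seq T).

(** The part of [f] that has no letter of [P] to strip. *)
Definition prefix_free f : ncseries K T :=
  fun w => if w is x :: _ then (if P x then 0 else f w) else f w.

(** The correction produced when [g] jumps over the first letter of [f]. *)
Definition corr f : ncseries K T := \sum_(x | P x) delta x * lstrip x f.

(** Left multiplication by [g] in an algebra where [g x = x g + delta x] for
    the letters [x] in [P], read on normal forms in which [g] has moved to the
    right of a maximal prefix of letters of [P]. *)
Fixpoint push f w : K :=
  if w is y :: v then
    (if P y then push (lstrip y f) v else if y == g then prefix_free f v else 0)
    + corr f w
  else 0.

Definition semidirect_op f : ncseries K T := push f.

Lemma lstrip_semidirect_op y f :
  lstrip y (semidirect_op f) =
    (if P y then semidirect_op (lstrip y f)
     else if y == g then prefix_free f else 0) + lstrip y (corr f).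
Proof. by apply: ncseriesP => w; rewrite /lstrip /= ncaddE; case: ifP => // _; case: ifP. Qed.

Lemma corr_linear : linear corr.
Proof.
move=> c f h; rewrite /corr scaler_sumr -big_split; apply: eq_bigr => x _ /=.
by rewrite linearP mulrDr nc_scalerAr.
Qed.

Lemma prefix_free_linear : linear prefix_free.
Proof.
move=> c f h; apply: ncseriesP => -[//|x w]; rewrite ncaddE ncscaleE /=.
by case: ifP => // _; rewrite mulr0 addr0.
Qed.

Lemma semidirect_op_linear : linear semidirect_op.
Proof.
move=> c f h; apply: ncseriesP => w; elim: w f h => [|y w IH] f h.
  by rewrite ncaddE ncscaleE /= mulr0 addr0.
rewrite ncaddE ncscaleE -!/(lstrip y _ w) !lstrip_semidirect_op corr_linear.
rewrite !lstrip_linear !ncaddE ncscaleE mulrDr addrACA; congr (_ + _).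
case: ifP => _; first by rewrite IH ncaddE ncscaleE.
by case: ifP => _; [rewrite prefix_free_linear | rewrite mulr0 addr0].
Qed.

HB.instance Definition _ :=
  GRing.isLinear.Build K (ncseries K T) (ncseries K T) _ semidirect_op
    semidirect_op_linear.

Lemma corr_lmul x f : P x -> corr (ncletter K x * f) = delta x * f.
Proof.
move=> Px; rewrite /corr (bigD1 x) //= lstrip_lmul eqxx scale1r.
rewrite big1 ?addr0 // => y /andP[_ /negPf yx].
by rewrite lstrip_lmul yx scale0r mulr0.
Qed.

Lemma semidirect_op_lmul x f : P x ->
  semidirect_op (ncletter K x * f) = ncletter K x * semidirect_op f + delta x * f.
Proof.
move=> Px; apply: lstrip_ext => [|y].
  by rewrite ncaddE !ncmul_nil delta0 !mul0r addr0.
rewrite lstrip_semidirect_op linearD /= corr_lmul // !lstrip_lmul; congr (_ + _).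
case: ifP => [_|Py]; first by rewrite linearZ.
have /negPf yx : y != x by apply: contraFneq Py => ->.
rewrite yx scale0r; case: ifP => // _; apply: ncseriesP => -[|z w] /=.
  by rewrite ncmul_nil mul0r.
by case: ifP => // Pz; rewrite lmul_cons; case: eqP Pz => [->|]; rewrite ?Px ?mul0r.
Qed.

Lemma semidirect_op_free f :
  (forall x, P x -> lstrip x f = 0) -> semidirect_op f = ncletter K g * f.
Proof.
move=> f0.
have c0 : corr f = 0 by rewrite /corr big1 // => x /f0 ->; rewrite mulr0.
apply: lstrip_ext => [|y]; first by rewrite ncmul_nil mul0r.
rewrite lstrip_semidirect_op c0 linear0 addr0 lstrip_lmul.
have -> : prefix_free f = f.
  apply: ncseriesP => -[//|x w] /=; case: ifP => // /f0 fx.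
  by rewrite -[RHS]/(lstrip x f w) fx.
case: ifP => [Py|_]; last by case: ifP; rewrite ?scale1r ?scale0r.
have /negPf -> : y != g by apply: contraTneq Py => ->.
by rewrite f0 // linear0 scale0r.
Qed.


(** Moving [g] over one letter of [P] costs exactly the relation assumed for that
    letter and leaves the same problem for the rest of the word, behind a letter:
    the error gains one order at each step. *)
Lemma semidirect_op_congr (I : set (ncseries K T)) f :
  two_sided_ideal I -> adic_closed I ->
  (forall x, P x ->
     I (ncletter K g * ncletter K x - ncletter K x * ncletter K g - delta x)) ->
  congr I (ncletter K g * f) (semidirect_op f).
Proof.
move=> Iid Icl Idelta; apply: (near_idealP Icl) => n.
elim: n f => [|n IH] f; first exact: near_ideal0.
pose h := f - \sum_(x | P x) ncletter K x * lstrip x f.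
have h0 x : P x -> lstrip x h = 0.
  move=> Px; rewrite linearB linear_sum /= (bigD1 x) //= lstrip_lmul eqxx scale1r.
  rewrite big1 ?addr0 ?subrr // => y /andP[_ yx].
  by rewrite lstrip_lmul eq_sym (negPf yx) scale0r.
have {1 2}-> : f = \sum_(x | P x) ncletter K x * lstrip x f + h.
  by rewrite addrC subrK.
rewrite linearD /= (semidirect_op_free h0) mulrDr opprD addrACA subrr addr0.
rewrite mulr_sumr linear_sum /= -sumrB big_mkcond; apply: (near_ideal_sum Iid) => x.
case: ifP => [Px|_]; last by apply: ideal_near; apply: ideal0.
rewrite semidirect_op_lmul // mulrA.
set f' := lstrip x f; set u := ncletter K g; set v := ncletter K x.
have -> : u * v * f' - (v * semidirect_op f' + delta x * f') =
    (u * v - v * u - delta x) * f' + v * (u * f' - semidirect_op f').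
  by rewrite !mulrBl mulrBr !mulrA opprD [RHS]addrAC [in RHS]addrA
    -[u * v * f' - _ + _]addrA addNr addr0 addrA -addrA.
apply: near_idealD => //; last by apply: near_ideal_lmul => //; exact: IH.
by apply: ideal_near; apply: idealMr => //; apply: Idelta.
Qed.

(** The operator follows any family of supports, indexed by degree, that is
    stable under putting a letter of [P] in front, putting [g] in front of a word
    with no prefix in [P], and applying the corrections. *)
Lemma semidirect_op_supported (S : nat -> pred (seq T)) n f :
  (forall x w, P x -> S 0%N (x :: w) = false) ->
  (forall k x w, P x -> S k.+1 (x :: w) = S k w) ->
  (forall k w, S k w -> ~~ P (head g w) -> S k.+1 (g :: w)) ->
  (forall k x h, P x -> supported (S k) h -> supported (S k.+2) (delta x * h)) ->
  supported (S n) f -> supported (S n.+1) (semidirect_op f).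
Proof.
move=> S0 SP Sg Sdelta.
have strip k h x : P x -> supported (S k.+1) h -> supported (S k) (lstrip x h).
  by move=> Px hS w Sw; apply: hS; rewrite SP.
have strip0 h x : P x -> supported (S 0%N) h -> lstrip x h = 0.
  by move=> Px hS; apply: ncseriesP => w; apply: hS; rewrite S0.
have corrS k h : supported (S k) h -> supported (S k.+1) (corr h).
  move=> hS w Sw; rewrite /corr ncsumE big1 // => x Px.
  case: k hS Sw => [|k] hS Sw; first by rewrite strip0 // mulr0.
  by apply: Sdelta Sw => //; apply: strip.
move=> fS w; elim: w n f fS => [//|y w IH] n f fS Sw.
rewrite /semidirect_op /= (corrS _ _ fS) // addr0.
case: ifP => [Py|Py].
  case: n fS Sw => [|n] fS Sw.
    by rewrite strip0 // -[LHS]/(semidirect_op 0 w) linear0.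
  by apply: (IH n); [apply: strip | rewrite -(SP _ y)].
case: eqP Sw => // -> Sw; case: w Sw {IH} => [|z w] Sw /=.
  by apply: fS; apply: contra Sw => Sn; apply: Sg.
case: ifP => // Pz.
by apply: fS; apply: contra Sw => Sn; apply: Sg => //=; rewrite Pz.
Qed.

End Semidirect.

(** * The concrete semidirect product *)

Section Model.
Variable K : comPzRingType.
Local Notation V := (ncseries K letter).
Local Notation X := (ncletter K).
Implicit Types (m f : V) (x y : letter) (w : seq letter).

Definition kernel_letter : pred letter := mem [:: X24; X34; X45].
Definition quotient_letter : pred letter := mem [:: X12; X23].

Definition comm f g : V := f * g - g * f.

(** Modulo the linear relations, [U B_5] has the five generators [X12], [X23],
    [X24], [X34], [X45]; the commutators of the first two with the last three
    stay in the free algebra on the last three, and [delta12] and [delta23] give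
    their values. *)
Definition delta12 x : V :=
  if x == X24 then comm (X X34 + X X45) (X X24) else 0.

Definition delta23 x : V :=
  if x == X24 then comm (X X24) (X X34) else
  if x == X34 then comm (X X34) (X X24) else 0.

Definition lmul x m : V := X x * m.

HB.instance Definition _ x :=
  GRing.isLinear.Build K V V _ (lmul x) (@ncletter_linear K letter x).

Definition op12 : {linear V -> V} := semidirect_op kernel_letter delta12 X12.
Definition op23 : {linear V -> V} := semidirect_op kernel_letter delta23 X23.

(** Coordinates of [X_ij] on [X12, X23, X24, X34, X45] modulo the linear
    relations. *)
Definition coord (i j : nat) : seq int :=
  let c12 := [:: 1; 0; 0; 0; 0] in
  let c13 := [:: -1; -1; 0; 0; 1] in
  let c14 := [:: 0; 0; -1; -1; -1] in
  let c15 := [:: 0; 1; 1; 1; 0] in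
  let c23 := [:: 0; 1; 0; 0; 0] in
  let c24 := [:: 0; 0; 1; 0; 0] in
  let c25 := [:: -1; -1; -1; 0; 0] in
  let c34 := [:: 0; 0; 0; 1; 0] in
  let c35 := [:: 1; 0; 0; -1; -1] in
  let c45 := [:: 0; 0; 0; 0; 1] in
  nth [::] (nth [::]
    [:: [:: [::]; c12; c13; c14; c15];
        [:: c12; [::]; c23; c24; c25];
        [:: c13; c23; [::]; c34; c35];
        [:: c14; c24; c34; [::]; c45];
        [:: c15; c25; c35; c45; [::]]] i) j.

Definition coordK x k : K := ((coord x.1 x.2)`_k)%:~R.

Definition letter_op x m : V :=
  coordK x 0 *: op12 m + coordK x 1 *: op23 m + coordK x 2 *: lmul X24 m +
  coordK x 3 *: lmul X34 m + coordK x 4 *: lmul X45 m.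

Lemma letter_op_linear x : linear (letter_op x).
Proof.
move=> c m m'; rewrite /letter_op !linearP /=.
apply: ncseriesP => w; rewrite !(ncaddE, ncscaleE); ring.
Qed.

HB.instance Definition _ x :=
  GRing.isLinear.Build K V V _ (letter_op x) (letter_op_linear x).

Definition opL x : {linear V -> V} := letter_op x.

Lemma letter_op12 m : letter_op X12 m = op12 m.
Proof.
by rewrite /letter_op /coordK /= mulr0z mulr1z scale1r !scale0r !addr0.
Qed.

Lemma letter_op23 m : letter_op X23 m = op23 m.
Proof.
by rewrite /letter_op /coordK /= mulr0z mulr1z scale1r !scale0r add0r !addr0.
Qed.

Lemma letter_op_kernel x m : kernel_letter x -> letter_op x m = X x * m.
Proof.
by rewrite /kernel_letter /= !inE => /or3P[] /eqP ->;
  rewrite /letter_op /coordK /= mulr0z mulr1z scale1r !scale0r ?addr0 ?add0r.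
Qed.

Lemma delta12_nil x : delta12 x [::] = 0.
Proof.
by rewrite /delta12 /comm; case: ifP => // _; rewrite ncsubE !ncmul_nil !mul0r mulr0 subrr. Qed.

Lemma delta23_nil x : delta23 x [::] = 0.
Proof.
by rewrite /delta23 /comm; do 2?case: ifP => // _; rewrite ncsubE !ncmul_nil !mul0r subrr.
Qed.

(** With [s, t, a, b, c] the operators of [X12, X23, X24, X34, X45], the
    hypotheses on [x] and [y] say that the commutator of two linear combinations
    vanishes once [s, b], [s, c], [t, c] are replaced by [0], [s, a] by
    [b + c, a], and [t, a] and [b, t] by [a, b]. *)
Lemma combinations_commute (s t a b c : {linear V -> V}) (x y : nat -> K) m :
  s (a m) = a (s m) + (b (a m) + c (a m) - (a (b m) + a (c m))) ->
  s (b m) = b (s m) -> s (c m) = c (s m) ->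
  t (a m) = a (t m) + (a (b m) - b (a m)) ->
  t (b m) = b (t m) + (b (a m) - a (b m)) -> t (c m) = c (t m) ->
  let q k l := x k * y l - x l * y k in
  q 0%N 1%N = 0 -> q 1%N 2%N + q 2%N 3%N = q 0%N 2%N + q 1%N 3%N ->
  q 2%N 4%N = q 0%N 2%N -> q 3%N 4%N = 0 ->
  let comb z m := z 0%N *: s m + z 1%N *: t m + z 2%N *: a m + z 3%N *: b m
                  + z 4%N *: c m in
  comb x (comb y m) = comb y (comb x m).
Proof.
move=> sa sb sc ta tb tc q q01 q12 q24 q34 /=.
have lin (o : {linear V -> V}) z : o (z 0%N *: s m + z 1%N *: t m + z 2%N *: a m
    + z 3%N *: b m + z 4%N *: c m) = z 0%N *: o (s m) + z 1%N *: o (t m)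
    + z 2%N *: o (a m) + z 3%N *: o (b m) + z 4%N *: o (c m).
  by rewrite 4!linearD !linearZ.
rewrite !lin sa sb sc ta tb tc.
apply: ncseriesP => w; rewrite !(ncaddE, ncoppE, ncscaleE).
apply/eqP; rewrite -subr_eq0; apply/eqP.
set u := s (t m) w; set v := t (s m) w.
set ab := a (b m) w; set ba := b (a m) w.
set ac := a (c m) w; set ca := c (a m) w.
set bc := b (c m) w; set cb := c (b m) w.
transitivity (q 0%N 1%N * (u - v)
  + (q 1%N 2%N + q 2%N 3%N - (q 0%N 2%N + q 1%N 3%N)) * (ab - ba)
  + (q 2%N 4%N - q 0%N 2%N) * (ac - ca) + q 3%N 4%N * (bc - cb)).
  rewrite /q; ring.
by rewrite q01 q12 q24 q34 !subrr !mul0r !addr0.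
Qed.

Lemma op12_lmul x m : kernel_letter x ->
  op12 (X x * m) = X x * op12 m + delta12 x * m.
Proof.
exact: (@semidirect_op_lmul K letter kernel_letter delta12 X12 delta12_nil x m).
Qed.

Lemma op23_lmul x m : kernel_letter x ->
  op23 (X x * m) = X x * op23 m + delta23 x * m.
Proof.
exact: (@semidirect_op_lmul K letter kernel_letter delta23 X23 delta23_nil x m).
Qed.

Lemma letter_op_comm x y m :
  let q k l := coordK x k * coordK y l - coordK x l * coordK y k in
  q 0%N 1%N = 0 -> q 1%N 2%N + q 2%N 3%N = q 0%N 2%N + q 1%N 3%N ->
  q 2%N 4%N = q 0%N 2%N -> q 3%N 4%N = 0 ->
  letter_op x (letter_op y m) = letter_op y (letter_op x m).
Proof.
apply: (@combinations_commute op12 op23 (lmul X24) (lmul X34) (lmul X45)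
  (coordK x) (coordK y) m).
- rewrite op12_lmul // /delta12 eqxx /comm mulrBl.
  by rewrite !mulrDl !mulrDr !mulrDl -!mulrA.
- by rewrite op12_lmul // /delta12 /= mul0r addr0.
- by rewrite op12_lmul // /delta12 /= mul0r addr0.
- by rewrite op23_lmul // /delta23 eqxx /comm mulrBl -!mulrA.
- by rewrite op23_lmul // /delta23 /= /comm mulrBl -!mulrA.
- by rewrite op23_lmul // /delta23 /= mul0r addr0.
Qed.

End Model.

(** * The relations of [U B_5] on the model and between series *)

Section Basis.
Variable R : realType.
Local Notation K := R[i].
Local Notation V := (ncseries K letter).
Local Notation X := (ncletter K).
Local Notation I := (closed_ideal_gen (@UB5_relator R)).
Implicit Types (f m : V) (x : letter) (w : seq letter).

Local Notation Iid := (closed_ideal_gen_ideal (@UB5_relator R)).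
Local Notation Icl := (@closed_ideal_gen_closed _ _ (@UB5_relator R)).

(** The numerical conditions under which two letters commute on the model, checked
    on the table of coordinates for every two disjoint pairs of indices. *)
Lemma coord_comm (i j k l : 'I_5) :
  i \notin [:: k; l] -> j \notin [:: k; l] ->
  let q a b := (coord i j)`_a * (coord k l)`_b - (coord i j)`_b * (coord k l)`_a in
  [/\ q 0%N 1%N = 0, q 1%N 2%N + q 2%N 3%N = q 0%N 2%N + q 1%N 3%N,
      q 2%N 4%N = q 0%N 2%N & q 3%N 4%N = 0].
Proof.
pose q i j k l a b :=
  (coord i j)`_a * (coord k l)`_b - (coord i j)`_b * (coord k l)`_a.
pose ok i j k l := [|| i == k, i == l, j == k, j == l |
  [&& q i j k l 0%N 1%N == 0,
      q i j k l 1%N 2%N + q i j k l 2%N 3%N == q i j k l 0%N 2%N + q i j k l 1%N 3%N,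
      q i j k l 2%N 4%N == q i j k l 0%N 2%N & q i j k l 3%N 4%N == 0]].
have : all (fun i => all (fun j => all (fun k => all (ok i j k)
         (iota 0 5)) (iota 0 5)) (iota 0 5)) (iota 0 5) by vm_compute.
have io (h : 'I_5) : (h : nat) \in iota 0 5 by rewrite mem_iota ltn_ord.
move=> /allP/(_ _ (io i))/allP/(_ _ (io j))/allP/(_ _ (io k))/allP/(_ _ (io l)).
rewrite /ok !inE !negb_or => okq /andP[ik il] /andP[jk jl].
move: okq; rewrite !val_eqE (negPf ik) (negPf il) (negPf jk) (negPf jl) /=.
by move=> /and4P[/eqP ? /eqP ? /eqP ? /eqP ?].
Qed.

Lemma ord5P (P : 'I_5 -> Prop) :
  P ix1 -> P ix2 -> P ix3 -> P ix4 -> P ix5 -> forall i, P i.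
Proof.
move=> P1 P2 P3 P4 P5 [i lti].
case: i lti => [|[|[|[|[|//]]]]] lti; by rewrite (bool_irrelevance lti isT).
Qed.

Lemma coord_sum (i : 'I_5) a : \sum_(j < 5) (coord i j)`_a = 0.
Proof.
case: a => [|[|[|[|[|a]]]]]; move: i; apply: ord5P;
  rewrite !big_ord_recl big_ord0 /= ?nth_nil //.
Qed.

Lemma coord_diag (i : 'I_5) : coord i i = [::].
Proof. by move: i; apply: ord5P. Qed.

Lemma coord_sym (i j : 'I_5) : coord i j = coord j i.
Proof. by move: i; apply: ord5P; move: j; apply: ord5P. Qed.

(** The linear relations hold by the choice of the coordinates, and the
    commutations by the choice of the operators; so the action on the model
    factors through [U B_5]. *)
Lemma UB5_relator_annihilated : @UB5_relator R `<=` annihilator (@opL K).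
Proof.
have act_letter n m x : act_deg (@opL K) n m (ncX R x) = (1%N == n)%:R *: letter_op x m.
  by rewrite /ncX act_deg_word.
have sumE J (F : J -> K) (r : seq J) m : \sum_(j <- r) F j *: m = (\sum_(j <- r) F j) *: m.
  by rewrite scaler_suml.
move=> _ [i|i j|i|i j k l ik jk] n m.
- rewrite act_letter /letter_op /coordK coord_diag !nth_nil mulr0z !scale0r.
  by rewrite !addr0 scaler0.
- by rewrite linearB /= !act_letter /letter_op /coordK coord_sym subrr.
- rewrite linear_sum /=; under eq_bigr do rewrite act_letter.
  rewrite -scaler_sumr /letter_op !big_split /= !sumE.
  have c0 k : \sum_(j < 5) coordK K (i, j) k = 0.
    by rewrite /coordK -(rmorph_sum intr) /= coord_sum.
  by rewrite !c0 !scale0r !addr0 scaler0.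
have prodE x y : ncX R x * ncX R y = ncword K [:: x; y].
  by rewrite (ncword_cons _ x [:: y]).
rewrite linearB /= !prodE !act_deg_word /=.
have [q1 q2 q3 q4] := coord_comm ik jk.
suff -> : letter_op (i, j) (letter_op (k, l) m) = letter_op (k, l) (letter_op (i, j) m)
  by rewrite subrr.
have toK a b : coordK K (i, j) a * coordK K (k, l) b - coordK K (i, j) b * coordK K (k, l) a
    = ((coord i j)`_a * (coord k l)`_b - (coord i j)`_b * (coord k l)`_a)%:~R.
  by rewrite intrB !intrM.
by apply: letter_op_comm; rewrite !toK -?intrD ?q1 ?q2 ?q3 ?q4.
Qed.

Lemma UB5_annihilated f n m : I f -> act_deg (@opL K) n m f = 0.
Proof.
move=> If; apply: (closed_ideal_gen_min _ _ UB5_relator_annihilated If).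
  exact: annihilator_ideal.
exact: annihilator_closed.
Qed.

Lemma letter_relator_diag (i : 'I_5) : I (X (i, i)).
Proof. by apply: sub_closed_ideal_gen; apply: UB5_diag. Qed.

Lemma letter_congr_sym (i j : 'I_5) : congr I (X (i, j)) (X (j, i)).
Proof. by apply: sub_closed_ideal_gen; apply: UB5_sym. Qed.

Lemma letter_comm (i j k l : 'I_5) : i \notin [:: k; l] -> j \notin [:: k; l] ->
  I (comm (X (i, j)) (X (k, l))).
Proof. by move=> ik jk; apply: sub_closed_ideal_gen; apply: UB5_comm. Qed.

Lemma row_sum (i : 'I_5) :
  I (X (i, ix1) + X (i, ix2) + X (i, ix3) + X (i, ix4) + X (i, ix5)).
Proof.
have <- : \sum_(j < 5) X (i, j) =
    X (i, ix1) + X (i, ix2) + X (i, ix3) + X (i, ix4) + X (i, ix5).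
  rewrite !big_ord_recl big_ord0 addr0 !addrA.
  by congr (X (i, _) + X (i, _) + X (i, _) + X (i, _) + X (i, _)); apply: val_inj.
by apply: sub_closed_ideal_gen; apply: UB5_sum.
Qed.

(** Adding the rows of three indices and subtracting the other two leaves twice
    the sum over the pairs among the three, minus twice the complementary
    variable. *)
Lemma complement_pair (a b c d e : 'I_5) : uniq [:: a; b; c; d; e] ->
  congr I (X (d, e)) (X (a, b) + X (a, c) + X (b, c)).
Proof.
move=> abcde.
pose row (i : 'I_5) := X (i, a) + X (i, b) + X (i, c) + X (i, d) + X (i, e).
have Irow i : I (row i).
  suff -> : row i = X (i, ix1) + X (i, ix2) + X (i, ix3) + X (i, ix4) + X (i, ix5).
    exact: row_sum.
  have -> : row i = \sum_(j <- [:: a; b; c; d; e]) X (i, j).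
    by rewrite !big_cons big_nil addr0 !addrA.
  have -> : X (i, ix1) + X (i, ix2) + X (i, ix3) + X (i, ix4) + X (i, ix5) =
      \sum_(j <- [:: ix1; ix2; ix3; ix4; ix5]) X (i, j).
    by rewrite !big_cons big_nil addr0 !addrA.
  apply: perm_big; apply: uniq_perm => // j.
  have full (l : seq 'I_5) : uniq l -> size l = 5 -> j \in l.
    move=> ul sl; have [//||_ ->] := @uniq_min_size _ l (enum 'I_5) ul.
    - by move=> h _; rewrite mem_enum.
    - by rewrite sl size_enum_ord.
    by rewrite mem_enum.
  by rewrite !full.
pose sy (i j : 'I_5) := X (i, j) - X (j, i).
have Isy i j : I (sy i j) by apply: letter_congr_sym.
pose di (i : 'I_5) := X (i, i).
have Idi i : I (di i) by apply: letter_relator_diag.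
pose rel := row a + row b + row c - row d - row e
  - (di a + di b + di c - di d - di e)
  + sy a b + sy a c + sy b c + sy e d
  + sy d a + sy d b + sy d c + sy e a + sy e b + sy e c.
have Irel : I rel.
  rewrite /rel; do 10![apply: (idealD Iid); last exact: Isy].
  apply: (idealB Iid).
    do 2![apply: (idealB Iid); last exact: Irow].
    by do 2![apply: (idealD Iid); last exact: Irow]; exact: Irow.
  do 2![apply: (idealB Iid); last exact: Idi].
  by do 2![apply: (idealD Iid); last exact: Idi]; exact: Idi.
suff relE : X (d, e) - (X (a, b) + X (a, c) + X (b, c)) = - 2^-1 *: rel.
  by rewrite /congr relE; apply: (idealZ Iid).
rewrite /rel /row /sy /di; apply: ncseriesP => w.
rewrite !(ncaddE, ncsubE, ncoppE, ncscaleE).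
pose v (i j : 'I_5) := X (i, j) w; rewrite -!/(v _ _); clearbody v.
by field.
Qed.

Lemma commDl f g h : comm (f + g) h = comm f h + comm g h.
Proof. by rewrite /comm mulrDl mulrDr opprD addrACA. Qed.

Lemma commNl f h : comm (- f) h = - comm f h.
Proof. by rewrite /comm mulNr mulrN opprB opprK addrC. Qed.

Lemma comm_anti f g : comm f g = - comm g f.
Proof. by rewrite /comm opprB. Qed.

Lemma commff f : comm f f = 0.
Proof. exact: subrr. Qed.

Lemma comm_congr f f' g : congr I f f' -> I (comm f g) -> I (comm f' g).
Proof.
move=> ff' fg; have -> : comm f' g = comm f g - comm (f - f') g.
  by rewrite commDl commNl opprD opprK addNKr.
apply: (idealB Iid) fg _; apply: (idealB Iid).
  exact: (idealMr Iid).
exact: (idealMl Iid).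
Qed.

(** [X35 = X12 + X14 + X24] as a complementary variable, and the row of index 4
    eliminates [X14]. *)
Lemma congr_X35 : congr I (X (ix3, ix5)) (X X12 - (X X34 + X X45)).
Proof.
have X35 : congr I (X (ix3, ix5)) (X X12 + X (ix1, ix4) + X X24).
  exact: complement_pair.
apply: (congr_trans Iid X35).
have -> : X X12 + X (ix1, ix4) + X X24 = X X12 + (X (ix1, ix4) + X X24).
  by rewrite addrA.
apply: (congrD Iid); first exact: (congr_refl Iid).
have := row_sum ix4; rewrite -/X45 => row4.
have s14 := letter_congr_sym ix1 ix4; have s24 := letter_congr_sym ix2 ix4.
have s34 := letter_congr_sym ix3 ix4; have d4 := letter_relator_diag ix4.
have := idealD Iid (idealD Iid s14 s24) (idealB Iid (idealD Iid s34 row4) d4).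
congr (I _); rewrite /X24 /X34 /X45.
apply: ncseriesP => w; rewrite !(ncaddE, ncsubE, ncoppE); ring.
Qed.

(** [X12] commutes with [X34] and [X45]; and [X24] commutes with [X35], which is
    [X12 - (X34 + X45)], so that [[X12, X24] = [X34 + X45, X24]]. *)
Lemma delta12_relation x : kernel_letter x ->
  I (X X12 * X x - X x * X X12 - delta12 K x).
Proof.
rewrite /kernel_letter /= !inE => /or3P[] /eqP ->; rewrite /delta12 ?eqxx /=.
- rewrite -/(comm _ _) -commNl -commDl; apply: comm_congr congr_X35 _.
  exact: letter_comm.
- by rewrite subr0; apply: letter_comm.
- by rewrite subr0; apply: letter_comm.
Qed.

(** [X23] commutes with [X45]; and [X24] and [X34] commute with [X15], which is
    [X23 + X24 + X34]. *)
Lemma delta23_relation x : kernel_letter x ->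
  I (X X23 * X x - X x * X X23 - delta23 K x).
Proof.
have X15 : congr I (X (ix1, ix5)) (X X23 + X X24 + X X34).
  exact: complement_pair.
rewrite /kernel_letter /= !inE => /or3P[] /eqP ->; rewrite /delta23 ?eqxx /=.
- have := comm_congr X15 (letter_comm (i := ix1) (j := ix5) (k := ix2) (l := ix4) isT isT).
  by rewrite !commDl commff addr0 [comm (X X34) _]comm_anti.
- have := comm_congr X15 (letter_comm (i := ix1) (j := ix5) (k := ix3) (l := ix4) isT isT).
  by rewrite !commDl commff addr0 [comm (X X24) _]comm_anti.
- by rewrite subr0; apply: letter_comm.
Qed.

(** The operators of [X12] and [X23] move these letters over a prefix in [X24],
    [X34], [X45] by the relations just established. *)
Lemma letter_op_congr x f : calA [:: x] -> congr I (X x * f) (letter_op x f).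
Proof.
rewrite /calA /words_in /= andbT => xA.
have [xk|xk] := boolP (kernel_letter x).
  by rewrite letter_op_kernel //; apply: (congr_refl Iid).
have : x = X12 \/ x = X23.
  by move: xA xk; rewrite /kernel_letter /= !inE =>
    /or4P[|||/orP[]] /eqP -> //= _; [left | right].
case=> ->.
  rewrite letter_op12; apply: semidirect_op_congr => //.
  - exact: delta12_nil.
  - exact: Iid.
  - exact: Icl.
  exact: delta12_relation.
rewrite letter_op23; apply: semidirect_op_congr => //.
- exact: delta23_nil.
- exact: Iid.
- exact: Icl.
exact: delta23_relation.
Qed.

End Basis.

(** * Normal forms *)

Section NormalForm.
Variable R : realType.
Local Notation K := R[i].
Local Notation V := (ncseries K letter).
Local Notation X := (ncletter K).
Local Notation I := (closed_ideal_gen (@UB5_relator R)).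
Implicit Types (f m : V) (x : letter) (w : seq letter).

Local Notation Iid := (closed_ideal_gen_ideal (@UB5_relator R)).
Local Notation Icl := (@closed_ideal_gen_closed _ _ (@UB5_relator R)).
Local Notation op := (@opL K).

Fixpoint normal_word w : bool :=
  if w is x :: v then
    if kernel_letter x then normal_word v else all quotient_letter w
  else true.

Lemma normal_wordP w : B4 w <-> normal_word w.
Proof.
split=> [[U [V [UA VA ->]]]|].
  elim: U UA => [_|x U IH] /=; last by move=> /andP[xk UA]; rewrite [kernel_letter _]xk IH.
  case: V VA => //= x V /andP[xq Vq].
  have -> : kernel_letter x = false.
    by move: xq; rewrite !inE => /orP[] /eqP ->.
  by rewrite [quotient_letter _]xq.
elim: w => [_|x w IH] /=; first by exists [::], [::].
case: ifP => [xk /IH [U [V [UA VA ->]]]|_ xw].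
  by exists (x :: U), V; split=> //; rewrite /words_in /= UA andbT.
by exists [::], (x :: w).
Qed.

Definition wordA : pred (seq letter) := all (mem [:: X34; X45; X24; X12; X23]).

Definition normal_deg n : pred (seq letter) :=
  fun w => normal_word w && (size w == n).

Lemma supportedB (S : pred (seq letter)) f g :
  supported S f -> supported S g -> supported S (f - g).
Proof. by move=> fS gS w Sw; rewrite ncsubE fS ?gS ?subrr. Qed.

Lemma supportedD (S : pred (seq letter)) f g :
  supported S f -> supported S g -> supported S (f + g).
Proof. by move=> fS gS w Sw; rewrite ncaddE fS ?gS ?addr0. Qed.

Lemma lmul_supported n x f : kernel_letter x ->
  supported (normal_deg n) f -> supported (normal_deg n.+1) (X x * f).
Proof.
move=> xk fS [|y w] Sw; first by rewrite ncmul_nil mul0r.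
rewrite lmul_cons; case: eqP Sw => [->|_ _]; last by rewrite mul0r.
by rewrite /normal_deg /= xk eqSS => /fS ->; rewrite mulr0.
Qed.

Lemma comm_supported n x y f : kernel_letter x -> kernel_letter y ->
  supported (normal_deg n) f -> supported (normal_deg n.+2) (comm (X x) (X y) * f).
Proof.
move=> xk yk fS; rewrite /comm mulrBl -!mulrA.
by apply: supportedB; do 2?apply: lmul_supported => //.
Qed.

Lemma letter_op_supported n x f : wordA [:: x] ->
  supported (normal_deg n) f -> supported (normal_deg n.+1) (letter_op x f).
Proof.
move=> xA fS.
have [xk|xk] := boolP (kernel_letter x).
  by rewrite letter_op_kernel //; apply: lmul_supported.
have S0 y w : kernel_letter y -> normal_deg 0 (y :: w) = false.
  by rewrite /normal_deg andbF.
have SP k y w : kernel_letter y -> normal_deg k.+1 (y :: w) = normal_deg k w.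
  by rewrite /normal_deg /= => ->; rewrite eqSS.
have Sq y k w : quotient_letter y -> ~~ kernel_letter y -> normal_deg k w ->
    ~~ kernel_letter (head y w) -> normal_deg k.+1 (y :: w).
  move=> yq /negPf yk; rewrite /normal_deg /= yk yq eqSS.
  by case: w => [//|z w] /= /andP[+ ->] /negPf zk; rewrite zk andbT.
have [->|->] : x = X12 \/ x = X23.
  by move: xA xk; rewrite /wordA /= andbT /kernel_letter /= !inE =>
    /or4P[|||/orP[]] /eqP -> //= _; [left | right].
  rewrite letter_op12; apply: semidirect_op_supported fS => //.
  - by move=> k w; apply: Sq.
  - move=> k y h yk hS; rewrite /delta12; case: ifP => _.
      rewrite commDl mulrDl; apply: supportedD; exact: comm_supported.
    by move=> w _; rewrite mul0r.
rewrite letter_op23; apply: semidirect_op_supported fS => //.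
- by move=> k w; apply: Sq.
- move=> k y h yk hS; rewrite /delta23.
  case: ifP => _; first exact: comm_supported.
  case: ifP => _; first exact: comm_supported.
  by move=> w _; rewrite mul0r.
Qed.

Lemma act_supported W : wordA W -> supported (normal_deg (size W)) (act op W 1).
Proof.
elim: W => [_|x W IH /=/andP[xA WA]]; first by case.
by apply: letter_op_supported; [rewrite /wordA /= xA | apply: IH].
Qed.

(** Read from right to left, a word of [B_4] never puts [X12] or [X23] in front of
    a letter to jump over, so no correction appears. *)
Lemma act_normal w : normal_word w -> act op w 1 = ncword K w.
Proof.
elim: w => [|x w IH] nw; first by rewrite ncword_nil.
rewrite ncword_cons /=; move: nw => /=; case: ifP => [xk /IH ->|xk /andP[xq wq]].
  exact: letter_op_kernel.
have {}IH : act op w 1 = ncword K w.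
  apply: IH; case: w wq => //= y w /andP[yq wq].
  by rewrite yq wq; move: yq; rewrite /quotient_letter /= !inE => /orP[] /eqP ->.
have free y : kernel_letter y -> lstrip y (ncword K w) = 0.
  move=> yk; case: w wq {IH} => [//|z w /= /andP[zq _]].
  rewrite lstrip_word; case: eqP yk => [->|]; last by rewrite scale0r.
  by move: zq; rewrite /quotient_letter /= !inE => /orP[] /eqP ->.
rewrite IH; move: xq; rewrite /quotient_letter /= !inE => /orP[] /eqP ->.
  rewrite letter_op12; exact: semidirect_op_free.
rewrite letter_op23; exact: semidirect_op_free.
Qed.

(** The action of [f] on [1]: the coefficient of a word only involves the words of
    [f] of the same length. *)
Definition normal_form f : V := fun w => act_deg op (size w) 1 f w.

Lemma normal_formB f g : normal_form (f - g) = normal_form f - normal_form g.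
Proof. by apply: ncseriesP => w; rewrite /normal_form linearB. Qed.

Lemma normal_form_ideal f : I f -> normal_form f = 0.
Proof. by move=> If; apply: ncseriesP => w; rewrite /normal_form UB5_annihilated. Qed.

Lemma normal_form_congr f g : congr I f g -> normal_form f = normal_form g.
Proof.
by move=> /normal_form_ideal; rewrite normal_formB => /eqP; rewrite subr_eq0 => /eqP.
Qed.

Lemma normal_form_normal f : supported normal_word f -> normal_form f = f.
Proof.
move=> fS; apply: ncseriesP => w; rewrite /normal_form /act_deg ncsumE.
rewrite (bigD1_seq w) ?uniq_words ?mem_words //= big1 => [|v vw].
  rewrite addr0 ncscaleE; have [nw|nw] := boolP (normal_word w).
    by rewrite act_normal // /ncword eqxx mulr1.
  by rewrite fS ?mul0r.
rewrite ncscaleE; have [nv|nv] := boolP (normal_word v).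
  by rewrite act_normal // /ncword eq_sym (negPf vw) mulr0.
by rewrite fS ?mul0r.
Qed.

Lemma act_deg_supported n f :
  supported wordA f -> supported (normal_deg n) (act_deg op n 1 f).
Proof.
move=> fA w Sw; rewrite /act_deg ncsumE big_seq big1 // => v.
rewrite mem_words ncscaleE => /eqP vn.
have [vA|vA] := boolP (wordA v); last by rewrite fA ?mul0r.
by rewrite act_supported ?mulr0 // vn.
Qed.

(** Stripping the first letter of [f] leaves series that are congruent to their
    normal forms up to one order less; putting the letter back on a normal form
    is its operator on the model, modulo the relations. *)
Lemma congr_normal_form f : supported wordA f -> congr I f (normal_form f).
Proof.
pose G n h := \sum_(k < n) act_deg op k 1 h.
have GS n h : G n.+1 h = h [::] *: (1 : V) + \sum_x op x (G n (lstrip x h)).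
  rewrite /G big_ord_recl act_deg0; congr (_ + _).
  under eq_bigr do rewrite lift0 act_degS.
  by rewrite exchange_big; apply: eq_bigr => x _; rewrite linear_sum.
have near n h : supported wordA h -> near_ideal I n (h - G n h).
  elim: n h => [|n IH] h hA; first exact: (near_ideal0 Iid).
  rewrite GS {1}(nc_decomp h) opprD addrACA subrr add0r -sumrB.
  apply: (near_ideal_sum Iid) => x.
  have [xA|xA] := boolP (wordA [:: x]); last first.
    have -> : lstrip x h = 0.
      by apply: ncseriesP => w; apply: hA; move: xA; rewrite /wordA /= andbT => /negPf ->.
    have -> : G n 0 = 0 by rewrite /G big1 // => k _; rewrite linear0.
    rewrite mulr0 (linear0 (op x)) subrr.
    by apply: ideal_near; have := ideal0 Iid.
  set h' := lstrip x h; rewrite -[X x * h'](subrK (X x * G n h')) -addrA -mulrBr.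
  apply: (near_idealD Iid).
    apply: (near_ideal_lmul Iid) => //; apply: IH => w nw; apply: hA.
    by apply: contra nw => /andP[].
  by apply: ideal_near; apply: letter_op_congr.
move=> fA; apply: (near_idealP Icl) => n.
have [g Ig fg] := near n f fA; exists g => // w wn; rewrite -fg // !ncsubE.
congr (_ - _); rewrite /G ncsumE (bigD1 (Ordinal wn)) //= big1 ?addr0 // => k kw.
apply: act_deg_supported => //; rewrite negb_and orbC; apply/orP; left.
by apply: contra kw => /eqP wk; apply/eqP/val_inj.
Qed.

Lemma normal_form_word W : wordA W -> normal_form (ncword K W) = act op W 1.
Proof.
move=> WA; apply: ncseriesP => w; rewrite /normal_form act_deg_word ncscaleE.
case: eqP => [_|/eqP Ww]; first by rewrite mul1r.
by rewrite mul0r act_supported // negb_and eq_sym Ww orbT.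
Qed.

Lemma B4_comb_supported (c : seq letter -> K) : supported normal_word (B4_comb c).
Proof.
move=> w nw; rewrite /B4_comb; case: ifP => // /set_mem /normal_wordP.
by rewrite (negPf nw).
Qed.

Lemma B4_comb_id f : supported normal_word f -> B4_comb f = f.
Proof.
move=> fS; apply: ncseriesP => w; rewrite /B4_comb; case: ifP => // wB.
rewrite fS //; apply/negP => /normal_wordP wB'.
by rewrite mem_set in wB.
Qed.

(** The normal form of [W] is an expansion of [W] in [B_4], and it is the only one
    since congruent series have the same normal form and combinations of [B_4]
    are their own. *)
Lemma l_coefE b W : B4 b -> calA W -> l_coef R b W = act op W 1 b.
Proof.
move=> bB WA; have nact : supported normal_word (act op W 1).
  by move=> w nw; apply: (act_supported WA); rewrite negb_and nw.
have congr_act : eqUB5 (ncword K W) (B4_comb (act op W 1)).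
  rewrite B4_comb_id // -normal_form_word //; apply: congr_normal_form => w wA.
  by rewrite /ncword; case: eqP wA => // ->; rewrite (WA : wordA W).
have : eqUB5 (ncword K W) (B4_comb (B4_coefs R W)).
  exact: (xgetPex _ (ex_intro [set c | eqUB5 (ncword K W) (B4_comb c)] _ congr_act)).
move=> /normal_form_congr; rewrite normal_form_word // normal_form_normal.
  by move=> ->; rewrite /B4_comb mem_set.
exact: B4_comb_supported.
Qed.

End NormalForm.

(** * Coefficients of a product of series *)

Section Factorizations.
Variables (K : comPzRingType) (T : eqType).
Implicit Types (W : seq T) (U : seq (seq T)).

Fixpoint splittings n W : seq (seq (seq T)) :=
  if n is n'.+1 then
    [seq take j W :: U | j <- iota 0 (size W).+1, U <- splittings n' (drop j W)]
  else if nilp W then [:: [::]] else [::].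

Lemma splittingsS n W : splittings n.+1 W =
  [seq take j W :: U | j <- iota 0 (size W).+1, U <- splittings n (drop j W)].
Proof. by []. Qed.

Lemma mem_splittings n W U :
  (U \in splittings n W) = (size U == n) && (flatten U == W).
Proof.
elim: n W U => [|n IH] W U.
  by rewrite /=; case: W => [|x W]; case: U => [|u U] //=; rewrite inE.
rewrite splittingsS; apply/allpairsPdep/idP => [[j [U' [jW]]]|].
  rewrite IH => /andP[/eqP sU /eqP fU] -> /=.
  by rewrite sU eqxx fU cat_take_drop eqxx.
case: U => [//|u U] /andP[sU /eqP fW]; exists (size u), U.
rewrite -[W](fW : u ++ flatten U = W).
rewrite mem_iota size_cat add0n ltnS leq_addr take_size_cat // drop_size_cat //.
by split; rewrite // IH eqxx andbT.
Qed.

Lemma uniq_splittings n W : uniq (splittings n W).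
Proof.
elim: n W => [|n IH] W; first by rewrite /=; case: ifP.
rewrite splittingsS.
apply: allpairs_uniq_dep => [||p q]; first exact: iota_uniq.
  by move=> j _; apply: IH.
move=> /allpairsPdep [j [U [jW _ ->]]] /allpairsPdep [j' [U' [jW' _ ->]]] /= [tj <-].
move: jW jW'; rewrite !mem_iota !add0n !ltnS => jW jW'.
by have := congr1 size tj; rewrite !size_takel // => ->.
Qed.

Lemma ncprodE n (F : 'I_n -> ncseries K T) W :
  (\prod_(i < n) F i) W =
  \sum_(U <- splittings n W) \prod_(i < n) F i (nth [::] U i).
Proof.
elim: n F W => [|n IH] F W.
  rewrite big_ord0 nconeE /=; case: W => [|x W] /=; last by rewrite big_nil.
  by rewrite big_seq1 big_ord0.
rewrite big_ord_recl ncmulE splittingsS big_allpairs_dep.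
rewrite -[iota _ _]/(index_iota 0 (size W).+1) big_mkord; apply: eq_bigr => j _.
rewrite IH mulr_sumr; apply: eq_bigr => U _.
by rewrite big_ord_recl.
Qed.

End Factorizations.

(** * The pentagon product *)

Section Pentagon.
Variables (R : realType) (zeta : seq bool -> R).
Local Notation K := R[i].
Local Notation V := (ncseries K letter).
Local Notation X := (ncletter K).
Local Notation I := (closed_ideal_gen (@UB5_relator R)).
Implicit Types (i : 'I_5) (x : letter) (w W U : seq letter).

Local Notation Iid := (closed_ideal_gen_ideal (@UB5_relator R)).
Local Notation Icl := (@closed_ideal_gen_closed _ _ (@UB5_relator R)).

(** The [i]-th factor of the pentagon product, rewritten on the letters of [A]. *)
Definition rho_series i : V := fun U =>
  (-1) ^+ depth0 (rho i U) * (zeta0 zeta (rho i U))%:C%C.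

Definition rho_sum i (z : bool) : V := \sum_(x | rho_letter i x == Some z) X x.

Lemma rho_size i w t : rho i w = Some t -> size t = size w.
Proof.
elim: w t => [|x w IH] t /=; first by case=> <-.
by case: (rho_letter i x) => // a; case: (rho i w) IH => // v IH [<-] /=; rewrite (IH v).
Qed.

Lemma rho_supported i U : rho i U != None -> wordA U.
Proof.
elim: U => [//|x U IH] /=; case xi: (rho_letter i x) => [a|//].
case: (rho i U) IH => // v -> // _; rewrite andbT.
by move: i xi; apply: ord5P; rewrite /rho_letter /= !inE; do !case: eqP => //= _.
Qed.

Lemma rho_series_supported i : supported wordA (rho_series i).
Proof.
move=> U UA; rewrite /rho_series; have := @rho_supported i U.
by case: (rho i U) => [v /(_ isT)|_]; [rewrite (negPf UA) | rewrite mulr0].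
Qed.

Lemma rho_prod i t w : (\prod_(z <- t) rho_sum i z) w = (rho i w == Some t)%:R.
Proof.
elim: t w => [|z t IH] [|x w]; rewrite ?big_nil ?big_cons ?nconeE //=.
- by case: (rho_letter i x) => // a; case: (rho i w).
- by rewrite ncmul_nil /rho_sum ncsumE big1 ?mul0r.
rewrite -[LHS]/(lstrip x _ w) lstripM [X in X *: _](_ : _ = 0) ?scale0r ?add0r; last first.
  by rewrite /rho_sum ncsumE big1.
have -> : lstrip x (rho_sum i z) = (rho_letter i x == Some z)%:R *: (1 : V).
  rewrite /rho_sum linear_sum /= big_mkcond (bigD1 x) //= big1 => [|y /negPf yx].
    by rewrite lstrip_letter eqxx scale1r addr0; case: ifP; rewrite ?scale1r ?scale0r.
  by rewrite lstrip_letter [x == y]eq_sym yx scale0r if_same.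
rewrite -nc_scalerAl mul1r ncscaleE IH -natrM mulnb; congr (nat_of_bool _)%:R.
case: (rho_letter i x) => // a; case: (rho i w) => [v|]; last by rewrite andbF.
exact/esym/eqseq_cons.
Qed.

(** Substituting sums of letters in a word [t] gives the sum of the words that
    [rho_i] sends to [t]. *)
Lemma ncsubst_rho i :
  ncsubst (Phi_KZ zeta) (rho_sum i false) (rho_sum i true) = rho_series i.
Proof.
apply: ncseriesP => w; rewrite /ncsubst.
have prodE n (t : n.-tuple bool) :
    (\prod_(z <- t) (if z then rho_sum i true else rho_sum i false)) w
    = (rho i w == Some (tval t))%:R.
  by rewrite -rho_prod; congr ((_ : V) w); apply: eq_bigr => -[].
under eq_bigr do under eq_bigr do rewrite prodE.
rewrite /rho_series; case rw: (rho i w) => [v|]; last first.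
  by rewrite mulr0 big1 // => n _; rewrite big1 // => t _; rewrite mulr0.
have sv := rho_size rw; have wv : (size v < (size w).+1)%N by rewrite sv.
rewrite (bigD1 (Ordinal wv)) //= [X in _ + X]big1 => [|n nv]; last first.
  rewrite big1 // => t _; case: eqP => [[vt]|]; last by rewrite mulr0.
  by case/eqP: nv; apply: val_inj; rewrite /= vt size_tuple.
rewrite addr0 (bigD1 (in_tuple v)) //= eqxx mulr1 big1 ?addr0 // => t tv.
case: eqP => [[vt]|]; last by rewrite mulr0.
by case/eqP: tv; apply: val_inj.
Qed.

Definition letters_to i (z : bool) : seq letter :=
  (if z then snd else fst) (nth ([::], [::]) rho_table i).

Lemma rho_letterE i x z : (rho_letter i x == Some z) = (x \in letters_to i z).
Proof.
have disj : all (fun y => y \notin letters_to i false) (letters_to i true).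
  by move: i; apply: ord5P.
rewrite /rho_letter /letters_to in disj *.
case: (nth _ _ _) disj => to0 to1 /= /allP disj.
case: z => /=; case: ifPn => // x0.
  by apply/esym/negP => /disj; rewrite x0.
by case: ifP.
by case: ifP.
Qed.

Lemma rho_sumE i z : rho_sum i z = \sum_(x <- letters_to i z) X x.
Proof.
rewrite big_uniq; first by apply: eq_bigl => x; exact: rho_letterE.
by case: z; move: i; apply: ord5P.
Qed.

(** The only letter of the pentagon product outside [A]. *)
Lemma congr_X51 : congr I (X X51) (\sum_(x <- [:: X23; X34; X24]) X x).
Proof.
rewrite !big_cons big_nil addr0 [X X34 + _]addrC addrA.
exact: (@complement_pair R ix2 ix3 ix4 ix5 ix1).
Qed.

Lemma congr_Phi i x y :
  congr I (X x) (rho_sum i false) -> congr I (X y) (rho_sum i true) ->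
  congr I (Phi_at zeta x y) (rho_series i).
Proof.
have rho_sum0 z : rho_sum i z [::] = 0 by rewrite /rho_sum ncsumE big1.
move=> xi yi; rewrite -ncsubst_rho; exact: (congr_subst Iid Icl).
Qed.

Definition pentagon_series : V := \prod_(i < 5) rho_series i.

Lemma pentagon_congr :
  congr I (Phi_at zeta X12 X23 * Phi_at zeta X34 X45 * Phi_at zeta X51 X12 *
           Phi_at zeta X23 X34 * Phi_at zeta X45 X51) pentagon_series.
Proof.
have -> : pentagon_series = rho_series ix1 * rho_series ix2 * rho_series ix3 *
    rho_series ix4 * rho_series ix5.
  rewrite /pentagon_series !big_ord_recl big_ord0 mulr1 !mulrA.
  by congr (rho_series _ * rho_series _ * rho_series _ * rho_series _ * rho_series _);
    apply: val_inj.
have single x : congr I (X x) (\sum_(y <- [:: x]) X y).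
  by rewrite big_seq1; exact: (congr_refl Iid).
do 4?apply: (congrM Iid); apply: congr_Phi; rewrite rho_sumE;
  by [apply: single | apply: congr_X51].
Qed.

Lemma pentagon_series_supported : supported wordA pentagon_series.
Proof.
have mulS (f g : V) : supported wordA f -> supported wordA g -> supported wordA (f * g).
  move=> fS gS w wA; rewrite ncmulE big1 // => k _.
  move: wA; rewrite -{1}(cat_take_drop k w) /wordA all_cat negb_and.
  by case/orP => [/fS -> | /gS ->]; rewrite ?mul0r ?mulr0.
rewrite /pentagon_series !big_ord_recl big_ord0 mulr1.
do 4![apply: (mulS); first exact: rho_series_supported].
exact: rho_series_supported.
Qed.

Lemma pentagon_coefE W : wordA W -> (pentagon_coef zeta W)%:C%C = pentagon_series W.
Proof.
move=> WA; rewrite /pentagon_series ncprodE /pentagon_coef.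
pose term (U : seq (seq letter)) :=
  (-1) ^+ (\sum_(i < 5) depth0 (rho i (nth [::] U i)))%N *
  \prod_(i < 5) zeta0 zeta (rho i (nth [::] U i)).
have -> : \sum_(U \in factorizations W)
     ((-1) ^+ (\sum_(i < 5) depth0 (rho i (tnth U i)))%N *
      \prod_(i < 5) zeta0 zeta (rho i (tnth U i))) =
    \sum_(U \in factorizations W) term (tval U).
  apply: eq_fsbigr => U _; rewrite /term.
  by congr ((-1) ^+ _ * _); apply: eq_bigr => i _; rewrite (tnth_nth [::]).
rewrite -fsbig_image; last by move=> U U' _ _; apply: val_inj.
have -> : [set tval U | U in factorizations W] = [set` splittings 5 W].
  apply/seteqP; split=> [_ [U [_ UW] <-]|U]; rewrite /mkset mem_splittings.
    by rewrite size_tuple UW !eqxx.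
  move=> /andP[sU /eqP UW]; exists (Tuple sU) => //; split=> // i.
  move: WA; rewrite -UW /wordA => /allP WA; apply/allP => x xU; apply: WA.
  by apply/flattenP; exists (tnth (Tuple sU) i) => //; apply: mem_tnth.
rewrite -fsbig_seq ?uniq_splittings // rmorph_sum; apply: eq_bigr => U _.
rewrite rmorphM rmorphXn rmorphN1 /= rmorph_prod.
by rewrite -prodrXr -big_split.
Qed.

Lemma pentagon_series_nil : zeta [::] = 1 -> pentagon_series [::] = 1.
Proof.
move=> z1; rewrite /pentagon_series !big_ord_recl big_ord0 !ncmul_nil.
by rewrite /rho_series /= z1 expr0 !mul1r.
Qed.

(** The sum over [A] is finite because the action is homogeneous. *)
Lemma pentagon_normal_form b : B4 b ->
  \sum_(W \in calA) (l_coef R b W * (pentagon_coef zeta W)%:C%C) =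
  normal_form pentagon_series b.
Proof.
move=> bB; pose H W := pentagon_series W * act (@opL K) W 1 b.
have HA W : ~~ wordA W -> H W = 0.
  by move=> WA; rewrite /H pentagon_series_supported // mul0r.
transitivity (\sum_(W \in calA) H W).
  apply: eq_fsbigr => W /set_mem WA.
  by rewrite l_coefE // pentagon_coefE // mulrC.
transitivity (\sum_(W \in [set: seq letter]) H W).
  by apply: fsbig_widen => // W [_ /negP WA]; apply: HA.
rewrite -(fsbig_widen [set` words letter (size b)]) //; last first.
  (* A word of another length acts on 1 in another degree. *)
  move=> W [_ /negP]; rewrite mem_words => bW.
  have [WA|/HA //] := boolP (wordA W).
  by rewrite /preimage /= /H act_supported ?mulr0 // negb_and eq_sym bW orbT.
by rewrite -fsbig_seq ?uniq_words // /normal_form /act_deg ncsumE.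
Qed.

End Pentagon.

Theorem theorem2p18 (R : realType) (zeta : seq bool -> R)
    (Hzeta : is_zeta_sh zeta) :
  eqUB5 (Phi_at zeta X12 X23 * Phi_at zeta X34 X45 * Phi_at zeta X51 X12 *
         Phi_at zeta X23 X34 * Phi_at zeta X45 X51) 1
  <->
  (forall b4 : seq letter, B4 b4 -> b4 <> [::] ->
     \sum_(W \in calA) (l_coef R b4 W * (pentagon_coef zeta W)%:C%C)
     = 0).
Proof.
have Iid := closed_ideal_gen_ideal (@UB5_relator R).
have PQ := pentagon_congr zeta; set P := (P in eqUB5 P 1).
have nf1 : normal_form 1 = 1 :> ncseries R[i] letter.
  by apply: normal_form_normal; case.
have Qnf := congr_normal_form (@pentagon_series_supported R zeta).
split=> [P1 b bB b0|H].
  have : normal_form (pentagon_series zeta) = 1.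
    rewrite -nf1; apply: normal_form_congr.
    exact: (congr_trans Iid (congr_sym Iid PQ) P1).
  by rewrite pentagon_normal_form // => ->; rewrite nconeE; case: b b0 {bB}.
suff Q1 : normal_form (pentagon_series zeta) = 1.
  by rewrite Q1 in Qnf; exact: (congr_trans Iid PQ Qnf).
apply: ncseriesP => b; rewrite nconeE.
have [bB|bB] := boolP (normal_word b).
  have [->|b0] := eqVneq b [::].
    rewrite /normal_form act_deg0 ncscaleE mulr1.
    exact: pentagon_series_nil (zeta_sh_nil Hzeta).
  have /normal_wordP bB4 := bB.
  rewrite -pentagon_normal_form // H //; last exact/eqP.
  by case: b b0 {bB bB4}.
rewrite /normal_form act_deg_supported ?negb_and ?bB //; first by case: b bB.
exact: pentagon_series_supported.
Qed.
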